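(* Let $\Sigma$ be a finite poset. The isomorphism of cochain complexes $\iota:C^\ast(\hat\Sigma)\to C^\ast_{S_\Sigma}(I_\Sigma,I_\Sigma)$, given for $f\in C^n(\hat\Sigma)$ by $$\iota_n(f)\big((\sigma_0,\sigma_1)\otimes_{S_\Sigma}\cdots\otimes_{S_\Sigma}(\sigma_{n-1},\sigma_n)\big)=f(\sigma_0\le\sigma_1\le\cdots\le\sigma_n)\cdot(\sigma_0,\sigma_n)$$ (and $\iota_0(f)((\sigma,\sigma))=f(\sigma)\cdot(\sigma,\sigma)$), preserves the cosimplicial structures; that is, it commutes with the coface maps, $F_i^n\circ\iota_{n-1}=\iota_n\circ\mathfrak F_i^{n-1}$, and with the codegeneracy maps, $D_i^n\circ\iota_n=\iota_{n-1}\circ\mathfrak D_i^n$.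
   Context: $\mathbb K$ is an arbitrary field. The nerve $\hat\Sigma$ of the finite poset $\Sigma$ is the simplicial set whose $n$-simplices are the weakly increasing sequences $(\sigma_0\le\dots\le\sigma_n)$ in $\Sigma$; the face $d_i^n:\hat\Sigma_n\to\hat\Sigma_{n-1}$ omits $\sigma_i$ and the degeneracy $s_i^n:\hat\Sigma_n\to\hat\Sigma_{n+1}$ repeats $\sigma_i$ ($0\le i\le n$). The singular cochain complex has $C^n(\hat\Sigma)=\mathrm{Hom}(\hat\Sigma_n,\mathbb K)$ (all functions $\hat\Sigma_n\to\mathbb K$), with cofaces $\mathfrak F_i^{n-1}(f)=f\circ d_i^n:C^{n-1}(\hat\Sigma)\to C^n(\hat\Sigma)$ and codegeneracies $\mathfrak D_i^n(f)=f\circ s_i^{n-1}:C^n(\hat\Sigma)\to C^{n-1}(\hat\Sigma)$. Its differential is dual to $\partial_n=\sum_{i=0}^n(-1)^id_i^n$. The incidence algebra $I_\Sigma$ is the unital associative $\mathbb K$-algebra with linear basis the pairs $(\sigma,\sigma')$, $\sigma\le\sigma'$, and product $(\sigma,\sigma')(\beta,\beta')=(\sigma,\beta')$ if $\sigma'=\beta$ and $0$ otherwise. $S_\Sigma\subset I_\Sigma$ is the commutative unital subalgebra generated by the pairs $(\sigma,\sigma)$. $BM$ denotes the category of $S_\Sigma$-bimodules. $I_\Sigma^{\otimes_{S_\Sigma}0}:=S_\Sigma$, and for $n\ge1$ the bimodule $I_\Sigma^{\otimes_{S_\Sigma}n}$ has as a basis the elements $(\sigma_0,\sigma_1)\otimes_{S_\Sigma}\cdots\otimes_{S_\Sigma}(\sigma_{n-1},\sigma_n)$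 with $\sigma_0\le\dots\le\sigma_n$. The relative Hochschild chain complex $T_{S_\Sigma}(I_\Sigma)=\bigoplus_{n\ge0}I_\Sigma^{\otimes_{S_\Sigma}n}$ has a simplicial structure, obtained from that of $\hat\Sigma$ through the linear isomorphism $(\sigma_0,\dots,\sigma_n)\mapsto(\sigma_0,\sigma_1)\otimes_{S_\Sigma}\cdots\otimes_{S_\Sigma}(\sigma_{n-1},\sigma_n)$ (and $(\sigma)\mapsto(\sigma,\sigma)$ for $n=0$). Explicitly, on $A=(\sigma_0,\sigma_1)\otimes_{S_\Sigma}\cdots\otimes_{S_\Sigma}(\sigma_{n-1},\sigma_n)$: for $0<i<n$, $d_i^n$ replaces $(\sigma_{i-1},\sigma_i)\otimes_{S_\Sigma}(\sigma_i,\sigma_{i+1})$ by $(\sigma_{i-1},\sigma_{i+1})$; $d_0^n(A)=(\sigma_1,\sigma_2)\otimes_{S_\Sigma}\cdots\otimes_{S_\Sigma}(\sigma_{n-1},\sigma_n)$; $d_n^n(A)=(\sigma_0,\sigma_1)\otimes_{S_\Sigma}\cdots\otimes_{S_\Sigma}(\sigma_{n-2},\sigma_{n-1})$; for $n=1$, $d_0^1((\sigma_0,\sigma_1))=(\sigma_1,\sigma_1)$ and $d_1^1((\sigma_0,\sigma_1))=(\sigma_0,\sigma_0)$. The degeneracy $s_i^n$ ($0\le i\le n$) inserts the factor $(\sigma_i,\sigma_i)$ after the first $i$ factors. The boundary is $\partial_n=\sum_{i=0}^n(-1)^id_i^n$. The relative Hochschild cochain complex has $C^n_{S_\Sigma}(I_\Sigma,I_\Sigma):=\mathrm{Hom}_{BM}(I_\Sigma^{\otimes_{S_\Sigma}n},I_\Sigma)$,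 its differential being obtained by right composition from $\partial$. Its cosimplicial structure is the one obtained by duality from the simplicial structure of $T_{S_\Sigma}(I_\Sigma)$: the cofaces $F_i^n:\mathrm{Hom}_{BM}(I_\Sigma^{\otimes_{S_\Sigma}n-1},I_\Sigma)\to\mathrm{Hom}_{BM}(I_\Sigma^{\otimes_{S_\Sigma}n},I_\Sigma)$ are $F_i^n(f)=f\circ d_i^n$ for all $0\le i\le n$, and the codegeneracies $D_i^n:\mathrm{Hom}_{BM}(I_\Sigma^{\otimes_{S_\Sigma}n},I_\Sigma)\to\mathrm{Hom}_{BM}(I_\Sigma^{\otimes_{S_\Sigma}n-1},I_\Sigma)$ are $D_i^n(f)=f\circ s_i^{n-1}$, $0\le i\le n-1$.
   Formalization: For i=0 and i=n, f∘d_i is not a bimodule morphism in general; the outer cofaces are taken as (σ_0,σ_1)·f(d_0 A) and f(d_n A)·(σ_{n-1},σ_n), and the Hochschild differential is the alternating sum of these cofaces. *)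

(* Defs.v *)
From HB Require Import structures.
From mathcomp Require Import all_boot all_order all_algebra.
From mathcomp Require Import boolp.

Set Implicit Arguments.
Unset Strict Implicit.
Unset Printing Implicit Defensive.

Import Order.TTheory GRing.Theory.

Local Open Scope ring_scope.

Section Nerve.

Context {disp : Order.disp_t} (P : finPOrderType disp).

Definition monotone n : pred {ffun 'I_n.+1 -> P} :=
  [pred c : {ffun 'I_n.+1 -> P} |
    [forall i : 'I_n.+1, forall j : 'I_n.+1, (i <= j)%N ==> (c i <= c j)%O]].

Record nerve n := Nerve {
  vertex :> {ffun 'I_n.+1 -> P};
  _ : monotone vertex }.

HB.instance Definition _ n := [isSub for @vertex n].
HB.instance Definition _ n := [Finite of nerve n by <:].

Lemma nerve_le n (c : nerve n) (i j : 'I_n.+1) : (i <= j)%N -> (c i <= c j)%O.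
Proof. by case: c => c /= /forallP /(_ i) /forallP /(_ j) /implyP. Qed.

Lemma pull_subproof m n (c : nerve n) (h : 'I_m.+1 -> 'I_n.+1)
    (h_mono : forall i j : 'I_m.+1, (i <= j)%N -> (h i <= h j)%N) :
  monotone [ffun j => c (h j)].
Proof.
apply/forallP => i; apply/forallP => j; apply/implyP => ij; rewrite !ffunE.
by apply: nerve_le; apply: h_mono.
Qed.

Lemma lift_mono n (i : 'I_n.+2) (j k : 'I_n.+1) :
  (j <= k)%N -> (lift i j <= lift i k)%N.
Proof. by rewrite /= leq_bump2. Qed.

Definition unlift_ord n (i : 'I_n.+1) (j : 'I_n.+2) : 'I_n.+1 :=
  inord (unbump i j).

Lemma val_unlift_ord n (i : 'I_n.+1) (j : 'I_n.+2) :
  unlift_ord i j = (if (j <= i)%N then j : nat else j.-1) :> nat.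
Proof.
rewrite /unlift_ord inordK /unbump; case: (leqP j i) => ij; rewrite ?subn0 ?subn1 //.
  by rewrite (leq_ltn_trans ij).
by rewrite prednK ?(leq_ltn_trans _ ij) // -ltnS.
Qed.

Lemma unlift_mono n (i : 'I_n.+1) (j k : 'I_n.+2) :
  (j <= k)%N -> (unlift_ord i j <= unlift_ord i k)%N.
Proof.
move=> jk; rewrite !val_unlift_ord; case: (leqP j i) => ji; case: (leqP k i) => ki //.
- by rewrite -ltnS prednK ?(leq_ltn_trans ji ki) // (leq_ltn_trans _ ki).
- by move: (leq_trans ji jk); rewrite ltnNge ki.
- by rewrite -!subn1 leq_sub2r.
Qed.

Definition face n (i : 'I_n.+2) (c : nerve n.+1) : nerve n :=
  Nerve (pull_subproof c (@lift_mono n i)).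

Definition degen n (i : 'I_n.+1) (c : nerve n) : nerve n.+1 :=
  Nerve (pull_subproof c (@unlift_mono n i)).

End Nerve.

Section IncidenceAlgebra.

Context {disp : Order.disp_t} (P : finPOrderType disp) (K : fieldType).

Definition pairs : Type := {p : P * P | (p.1 <= p.2)%O}.
HB.instance Definition _ := Finite.on pairs.

Definition incalg : Type := {ffun pairs -> K^o}.
HB.instance Definition _ := Vector.on incalg.

Definition icoef (a : incalg) (x y : P) : K :=
  if insub (x, y) is Some p then a p else 0.

(* The basis element (x, y); it is only meaningful when x <= y, and is 0     *)
(* otherwise.                                                                *)
Definition pr (x y : P) : incalg := [ffun p => (val p == (x, y))%:R].

Definition inc_mul (a b : incalg) : incalg :=
  [ffun p => \sum_y icoef a (val p).1 y * icoef b y (val p).2].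

Definition inc_one : incalg := [ffun p => ((val p).1 == (val p).2)%:R].

Lemma icoefE (a : incalg) (p : pairs) : a p = icoef a (val p).1 (val p).2.
Proof. by rewrite /icoef -surjective_pairing valK. Qed.

Lemma icoef_out a x y : ~~ (x <= y)%O -> icoef a x y = 0.
Proof. by move=> xy; rewrite /icoef insubF //=; apply: negbTE. Qed.

Lemma incP (a b : incalg) : (forall x y, icoef a x y = icoef b x y) -> a = b.
Proof. by move=> ab; apply/ffunP => p; rewrite !icoefE ab. Qed.

Lemma icoef_ffun (g : P -> P -> K) x y :
  icoef [ffun p => g (val p).1 (val p).2] x y = if (x <= y)%O then g x y else 0.
Proof.
rewrite /icoef; case: insubP => [p xy vp|/negbTE /= -> //].
by rewrite ffunE vp /=; move: xy => /= ->.
Qed.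

Lemma icoef_pr x y u v : (x <= y)%O -> icoef (pr x y) u v = ((u == x) && (v == y))%:R.
Proof.
move=> xy; rewrite /icoef; case: insubP => [p _ vp|/= uv].
  by rewrite ffunE vp xpair_eqE.
case: andP => // -[/eqP ux /eqP vy]; by rewrite ux vy xy in uv.
Qed.

Lemma icoef1 x y : icoef inc_one x y = (x == y)%:R.
Proof.
rewrite (icoef_ffun (fun x y => (x == y)%:R)); case: ifP => // xy.
by case: eqP => // e; rewrite e lexx in xy.
Qed.

Lemma icoefM a b x z : icoef (inc_mul a b) x z = \sum_y icoef a x y * icoef b y z.
Proof.
rewrite (icoef_ffun (fun x z => \sum_y icoef a x y * icoef b y z)).
case: ifP => // /negbT xz; rewrite big1 // => y _.
case: (boolP (x <= y)%O) => xy; last by rewrite (icoef_out _ xy) mul0r.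
case: (boolP (y <= z)%O) => yz; last by rewrite (icoef_out _ yz) mulr0.
by rewrite (le_trans xy yz) in xz.
Qed.

Lemma icoefD (a b : incalg) x y : icoef (a + b) x y = icoef a x y + icoef b x y.
Proof. by rewrite /icoef; case: insub => [p|]; rewrite ?ffunE ?addr0. Qed.

Lemma icoefZ k (a : incalg) x y : icoef (k *: a) x y = k * icoef a x y.
Proof. by rewrite /icoef; case: insub => [p|]; rewrite ?ffunE ?mulr0. Qed.

Lemma icoef0 x y : icoef 0 x y = 0.
Proof. by rewrite /icoef; case: insub => [p|]; rewrite ?ffunE. Qed.

Lemma inc_mulA : associative inc_mul.
Proof.
move=> a b c; apply: incP => x w; rewrite !icoefM.
under eq_bigr => y _ do rewrite icoefM mulr_sumr.
rewrite exchange_big; apply: eq_bigr => z _; rewrite icoefM mulr_suml.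
by apply: eq_bigr => y _; rewrite mulrA.
Qed.

Lemma inc_mul1 : left_id inc_one inc_mul.
Proof.
move=> a; apply: incP => x y; rewrite icoefM (bigD1 x) //= icoef1 eqxx mul1r.
by rewrite big1 ?addr0 // => z zx; rewrite icoef1 eq_sym (negbTE zx) mul0r.
Qed.

Lemma inc_mulr1 : right_id inc_one inc_mul.
Proof.
move=> a; apply: incP => x y; rewrite icoefM (bigD1 y) //= icoef1 eqxx mulr1.
by rewrite big1 ?addr0 // => z zx; rewrite icoef1 (negbTE zx) mulr0.
Qed.

Lemma inc_mulDl : left_distributive inc_mul +%R.
Proof.
move=> a b c; apply: incP => x y; rewrite icoefD !icoefM -big_split /=.
by apply: eq_bigr => z _; rewrite icoefD mulrDl.
Qed.

Lemma inc_mulDr : right_distributive inc_mul +%R.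
Proof.
move=> a b c; apply: incP => x y; rewrite icoefD !icoefM -big_split /=.
by apply: eq_bigr => z _; rewrite icoefD mulrDr.
Qed.

(* The hierarchy only has nontrivial algebras, and P may be empty: hence a   *)
(* ring and a vector space, with incZAl and incZAr as compatibility.         *)
HB.instance Definition _ := GRing.Zmodule_isPzRing.Build incalg
  inc_mulA inc_mul1 inc_mulr1 inc_mulDl inc_mulDr.

Lemma incZAl (k : K) (a b : incalg) : k *: (a * b) = (k *: a) * b.
Proof.
apply: incP => x y; rewrite icoefZ !icoefM mulr_sumr.
by apply: eq_bigr => z _; rewrite icoefZ mulrA.
Qed.

Lemma incZAr (k : K) (a b : incalg) : k *: (a * b) = a * (k *: b).
Proof.
apply: incP => x y; rewrite icoefZ !icoefM mulr_sumr.
by apply: eq_bigr => z _; rewrite icoefZ mulrCA.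
Qed.

Lemma pr_mul x y z w : (x <= y)%O -> (z <= w)%O ->
  pr x y * pr z w = if y == z then pr x w else 0.
Proof.
move=> xy zw; apply: incP => u v; rewrite icoefM (bigD1 y) //=.
rewrite big1 ?addr0 => [|t ty]; last by rewrite icoef_pr // (negbTE ty) andbF mul0r.
rewrite !icoef_pr // eqxx andbT; case: (y =P z) => [yz|_]; last by rewrite /= icoef0 mulr0.
by rewrite icoef_pr ?(le_trans xy) ?yz //= -natrM mulnb.
Qed.

Lemma inc_expand (a : incalg) :
  a = \sum_(p : pairs) a p *: pr (val p).1 (val p).2.
Proof.
apply/ffunP => q; rewrite sum_ffunE (bigD1 q) //= big1 => [|p pq].
  by rewrite !ffunE -surjective_pairing eqxx addr0 /GRing.scale /= mulr1.
rewrite !ffunE -surjective_pairing (inj_eq val_inj) eq_sym (negbTE pq).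
by rewrite /GRing.scale /= mulr0.
Qed.

(* The unital subalgebra generated by the pairs (x, x). *)
Definition inc_diag : {pred incalg} :=
  fun a => `[< forall B : {pred incalg},
     [/\ 1 \in B, GRing.linear_closed B & GRing.mulr_2closed B] ->
     (forall x, pr x x \in B) -> a \in B >].

Lemma pr_diag x : pr x x \in inc_diag.
Proof. by apply/asboolP => B _; apply. Qed.

Lemma inc_diagP a : a \in inc_diag -> forall x y, x != y -> icoef a x y = 0.
Proof.
move=> /asboolP /(_ [pred a | [forall x, forall y, (x != y) ==> (icoef a x y == 0)]]).
have PE b : reflect (forall x y, x != y -> icoef b x y = 0)
    [forall x, forall y, (x != y) ==> (icoef b x y == 0)].
  apply: (iffP forallP) => [H x y xy|H x].
    by move: (H x) => /forallP/(_ y); rewrite xy => /eqP.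
  by apply/forallP => y; apply/implyP => xy; rewrite H.
move=> H; apply/PE; apply: H.
- split; first by apply/PE => x y xy; rewrite icoef1 (negbTE xy).
    move=> k u v /PE Hu /PE Hv; apply/PE => x y xy.
    by rewrite icoefD icoefZ Hu // Hv // mulr0 addr0.
  move=> u v /PE Hu /PE Hv; apply/PE => x y xy.
  rewrite icoefM big1 // => z _; case: (eqVneq x z) => [<-|xz].
    by rewrite Hv // mulr0.
  by rewrite Hu // mul0r.
- by move=> z; apply/PE => x y xy; rewrite icoef_pr //; case: andP xy => // -[/eqP -> /eqP ->]; rewrite eqxx.
Qed.

Lemma inc_diag_expand a : a \in inc_diag -> a = \sum_x icoef a x x *: pr x x.
Proof.
move=> Sa; apply: incP => x y.
have -> : icoef (\sum_z icoef a z z *: pr z z) x y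
    = \sum_z icoef a z z * ((x == z) && (y == z))%:R.
  elim/big_rec2: _ => [|z u v _ <-]; first exact: icoef0.
  by rewrite icoefD icoefZ icoef_pr.
case: (eqVneq x y) => [<-|xy].
  rewrite (bigD1 x) //= eqxx mulr1 big1 ?addr0 // => z.
  by rewrite eq_sym => /negbTE ->; rewrite mulr0.
rewrite inc_diagP // big1 // => z _; case: (eqVneq x z) => [<-|_] /=.
  by rewrite eq_sym (negbTE xy) mulr0.
by rewrite mulr0.
Qed.

Lemma diag_mul_pr s x y : s \in inc_diag -> (x <= y)%O ->
  s * pr x y = icoef s x x *: pr x y.
Proof.
move=> Ss xy; apply: incP => u v; rewrite icoefZ icoefM (bigD1 x) //= big1.
  rewrite addr0 !icoef_pr // eqxx /=; case: (eqVneq u x) => [-> //|ux] /=.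
  by rewrite inc_diagP // mul0r mulr0.
by move=> t tx; rewrite icoef_pr // (negbTE tx) mulr0.
Qed.

Lemma pr_mul_diag s x y : s \in inc_diag -> (x <= y)%O ->
  pr x y * s = icoef s y y *: pr x y.
Proof.
move=> Ss xy; apply: incP => u v; rewrite icoefZ icoefM (bigD1 y) //= big1.
  rewrite addr0 !icoef_pr // eqxx andbT; case: (eqVneq v y) => [->|vy] /=.
    by rewrite andbT mulrC.
  by rewrite inc_diagP 1?eq_sym // andbF !mulr0.
by move=> t tx; rewrite icoef_pr // (negbTE tx) andbF mul0r.
Qed.

End IncidenceAlgebra.

Arguments pr {disp P K}.
Arguments inc_diag {disp P K}.

Section Complexes.

Context {disp : Order.disp_t} (P : finPOrderType disp) (K : fieldType).

Local Notation I := (incalg P K).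
Local Notation nerve := (nerve P).

Definition cochain n : Type := {ffun nerve n -> K^o}.
HB.instance Definition _ n := Vector.on (cochain n).

Definition ccoface n (i : 'I_n.+2) (f : cochain n) : cochain n.+1 :=
  [ffun c => f (face i c)].

Definition ccodegen n (i : 'I_n.+1) (f : cochain n.+1) : cochain n :=
  [ffun c => f (degen i c)].

Definition cdiff n (f : cochain n) : cochain n.+1 :=
  \sum_(i < n.+2) (-1) ^+ i *: ccoface i f.

(* The n-th tensor power of I over S = inc_diag, through its basis of        *)
(* composable tensors, indexed by the nerve.  See tprod_universal,   *)
(* tbasis_steps, lact_tprod and ract_tprod for n > 0, and tens0_diag for     *)
(* n = 0, where the tensor power is S itself.                                *)
Definition tens n : Type := {ffun nerve n -> K^o}.
HB.instance Definition _ n := Vector.on (tens n).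

Definition tbasis n (c : nerve n) : tens n := [ffun c' => (c' == c)%:R].

Definition lact n (s : I) (t : tens n) : tens n :=
  [ffun c : nerve n => icoef s (c ord0) (c ord0) * t c].

Definition ract n (t : tens n) (s : I) : tens n :=
  [ffun c : nerve n => t c * icoef s (c ord_max) (c ord_max)].

Definition lext n (V : vectType K) (u : nerve n -> V) : 'Hom(tens n, V) :=
  linfun (fun t : tens n => \sum_c t c *: u c).

Definition tface n (i : 'I_n.+2) : 'Hom(tens n.+1, tens n) :=
  lext (fun c => tbasis (face i c)).

Definition tdegen n (i : 'I_n.+1) : 'Hom(tens n, tens n.+1) :=
  lext (fun c => tbasis (degen i c)).

Definition is_bimod n : {pred 'Hom(tens n, I)} :=
  fun h => `[< forall s, s \in inc_diag -> forall t,
     h (lact s t) = s * h t /\ h (ract t s) = h t * s >].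

Record bimod_hom n := BimodHom {
  bimod_val :> 'Hom(tens n, I);
  _ : bimod_val \in @is_bimod n }.

HB.instance Definition _ n := [isSub for @bimod_val n].
HB.instance Definition _ n := [Choice of bimod_hom n by <:].

Lemma is_bimodP n (h : 'Hom(tens n, I)) :
  reflect (forall s, s \in inc_diag -> forall t,
     h (lact s t) = s * h t /\ h (ract t s) = h t * s) (h \in @is_bimod n).
Proof. exact: asboolP. Qed.

Lemma is_bimod_submod n : submod_closed (@is_bimod n).
Proof.
split=> [|k g h /is_bimodP Hg /is_bimodP Hh]; apply/is_bimodP => s Ss t.
  by rewrite !lfunE mulr0 mul0r.
have [g1 g2] := Hg s Ss t; have [h1 h2] := Hh s Ss t.
by rewrite !add_lfunE !scale_lfunE g1 g2 h1 h2 mulrDr mulrDl -incZAl -incZAr.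
Qed.

HB.instance Definition _ n :=
  GRing.isSubmodClosed.Build K _ (@is_bimod n) (@is_bimod_submod n).
HB.instance Definition _ n := [SubChoice_isSubLmodule of bimod_hom n by <:].

Lemma lextE n (V : vectType K) (u : nerve n -> V) t :
  lext u t = \sum_c t c *: u c.
Proof.
have lin : linear (fun t : tens n => \sum_c t c *: u c).
  move=> k x y; rewrite scaler_sumr -big_split /=.
  by apply: eq_bigr => c _; rewrite !ffunE scalerDl scalerA.
pose L := GRing.isLinear.Build _ _ _ _ _ lin.
pose f : {linear tens n -> V} := HB.pack (fun t : tens n => \sum_c t c *: u c) L.
exact: (lfunE f).
Qed.

Lemma lext_tbasis n (V : vectType K) (u : nerve n -> V) c :
  lext u (tbasis c) = u c.
Proof.
rewrite lextE (bigD1 c) //= ffunE eqxx scale1r big1 ?addr0 // => d dc.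
by rewrite ffunE (negbTE dc) scale0r.
Qed.

Lemma tens_expand n (t : tens n) : t = \sum_c t c *: tbasis c.
Proof.
apply/ffunP => d; rewrite sum_ffunE (bigD1 d) //= big1 => [|c cd].
  by rewrite !ffunE eqxx addr0 /GRing.scale /= mulr1.
by rewrite !ffunE eq_sym (negbTE cd) /GRing.scale /= mulr0.
Qed.

Lemma tens_ext n (V : vectType K) (g h : 'Hom(tens n, V)) :
  (forall c, g (tbasis c) = h (tbasis c)) -> g = h.
Proof.
move=> gh; apply/lfunP => t; rewrite (tens_expand t) !linear_sum.
by apply: eq_bigr => c _; rewrite !linearZ /= gh.
Qed.

Lemma tface_tbasis n (i : 'I_n.+2) c : tface i (tbasis c) = tbasis (face i c).
Proof. exact: lext_tbasis. Qed.

Lemma tdegen_tbasis n (i : 'I_n.+1) c : tdegen i (tbasis c) = tbasis (degen i c).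
Proof. exact: lext_tbasis. Qed.

Lemma lact_tbasis n s (c : nerve n) :
  lact s (tbasis c) = icoef s (c ord0) (c ord0) *: tbasis c.
Proof.
apply/ffunP => d; rewrite !ffunE /GRing.scale /=.
by case: eqP => [-> //|_]; rewrite !mulr0.
Qed.

Lemma ract_tbasis n s (c : nerve n) :
  ract (tbasis c) s = icoef s (c ord_max) (c ord_max) *: tbasis c.
Proof.
apply/ffunP => d; rewrite !ffunE /GRing.scale /= mulrC.
by case: eqP => [-> //|_]; rewrite !mulr0.
Qed.

Lemma lactE n s (t : tens n) : lact s t = \sum_c t c *: lact s (tbasis c).
Proof.
rewrite {1}(tens_expand (lact s t)); apply: eq_bigr => c _.
by rewrite lact_tbasis scalerA ffunE mulrC.
Qed.

Lemma ractE n s (t : tens n) : ract t s = \sum_c t c *: ract (tbasis c) s.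
Proof.
rewrite {1}(tens_expand (ract t s)); apply: eq_bigr => c _.
by rewrite ract_tbasis scalerA ffunE.
Qed.

Lemma nerve_ends n (c : nerve n) : (c ord0 <= c ord_max)%O.
Proof. by apply: nerve_le. Qed.

Lemma is_bimod_basisP n (h : 'Hom(tens n, I)) :
  (forall c, exists k, h (tbasis c) = k *: pr (c ord0) (c ord_max))
  <-> h \in @is_bimod n.
Proof.
split=> [hP|/is_bimodP hP c].
  apply/is_bimodP => s Ss t; rewrite lactE ractE.
  have -> : h t = \sum_c t c *: h (tbasis c).
    rewrite {1}(tens_expand t) linear_sum.
    by apply: eq_bigr => c _; rewrite linearZ.
  rewrite !linear_sum mulr_sumr mulr_suml; split; apply: eq_bigr => c _; have [k hk] := hP c.
    rewrite linearZ /= lact_tbasis linearZ /= hk -incZAr; congr (_ *: _).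
    by rewrite -incZAr diag_mul_pr ?nerve_ends // !scalerA mulrC.
  rewrite linearZ /= ract_tbasis linearZ /= hk -incZAl; congr (_ *: _).
  by rewrite -incZAl pr_mul_diag ?nerve_ends // !scalerA mulrC.
exists (icoef (h (tbasis c)) (c ord0) (c ord_max)); apply: incP => x y.
rewrite icoefZ icoef_pr ?nerve_ends //.
have [l _] := hP _ (pr_diag _ (c ord0)) (tbasis c).
have [_ r] := hP _ (pr_diag _ (c ord_max)) (tbasis c).
move: l r; rewrite lact_tbasis ract_tbasis !icoef_pr // !eqxx !scale1r => l r.
case: (eqVneq x (c ord0)) => [->|xc] /=.
  case: (eqVneq y (c ord_max)) => [->|yc] /=; first by rewrite mulr1.
  rewrite r icoefM mulr0 big1 // => z _.
  by rewrite icoef_pr // (negbTE yc) andbF mulr0.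
rewrite mulr0 l icoefM big1 // => z _.
by rewrite icoef_pr // (negbTE xc) mul0r.
Qed.

Lemma bimod_tbasis n (h : bimod_hom n) c :
  exists k, h (tbasis c) = k *: pr (c ord0) (c ord_max).
Proof. by case: h => h /= /is_bimod_basisP. Qed.

Definition iotaH_fun n (f : cochain n) : 'Hom(tens n, I) :=
  lext (fun c : nerve n => f c *: pr (c ord0) (c ord_max)).

Lemma iotaH_subproof n (f : cochain n) : iotaH_fun f \in @is_bimod n.
Proof.
by apply/is_bimod_basisP => c; exists (f c); rewrite lext_tbasis.
Qed.

Definition iotaH n (f : cochain n) : bimod_hom n := BimodHom (iotaH_subproof f).

Lemma iotaH_tbasis n (f : cochain n) c :
  iotaH f (tbasis c) = f c *: pr (c ord0) (c ord_max).
Proof. exact: lext_tbasis. Qed.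

(* The composite h \o d_i is a morphism of bimodules when 0 < i < n + 1.  It *)
(* is not one in general for the two outer faces, which drop an end vertex   *)
(* (outer_face_not_bimod); there the factor lost by d_i multiplies the value *)
(* of h, as in the Hochschild complex.  For every i, hcoface i h is h \o d_i *)
(* as soon as the latter is a morphism of bimodules (coface_comp), and it is *)
(* the only morphism of bimodules with the same coefficients as h \o d_i     *)
(* (coface_dual and aug_inj).                                                *)
Definition coface_fun n (i : 'I_n.+2) (h : 'Hom(tens n, I)) :
    'Hom(tens n.+1, I) :=
  if i == ord0 then
    lext (fun c : nerve n.+1 =>
            pr (c ord0) (c (inord 1)) * h (tface i (tbasis c)))
  else if i == ord_max then
    lext (fun c => h (tface i (tbasis c)) * pr (c (inord n)) (c ord_max))
  else (h \o tface i)%VF.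

Lemma coface_fun_tbasis n (i : 'I_n.+2) (h : 'Hom(tens n, I)) c k :
  h (tbasis (face i c)) = k *: pr (face i c ord0) (face i c ord_max) ->
  coface_fun i h (tbasis c) = k *: pr (c ord0) (c ord_max).
Proof.
move=> hk; rewrite /coface_fun; case: (eqVneq i ord0) => [i0|i0].
  rewrite lext_tbasis tface_tbasis hk i0 !ffunE.
  have -> : lift ord0 (ord0 : 'I_n.+1) = inord 1.
    by apply: val_inj; rewrite /= inordK.
  have -> : lift ord0 (ord_max : 'I_n.+1) = ord_max by apply: val_inj.
  by rewrite -incZAr pr_mul ?eqxx // nerve_le ?inordK.
case: (eqVneq i ord_max) => [im|im].
  rewrite lext_tbasis tface_tbasis hk im !ffunE.
  have -> : lift ord_max (ord0 : 'I_n.+1) = ord0.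
    by apply: val_inj; rewrite /= /bump.
  have -> : lift ord_max (ord_max : 'I_n.+1) = inord n.
    by apply: val_inj; rewrite /= inordK /bump ?ltnn //.
  by rewrite -incZAl pr_mul ?eqxx // nerve_le ?inordK.
rewrite comp_lfunE tface_tbasis hk !ffunE.
have i_gt0 : (0 < i)%N by rewrite lt0n; apply: contraNneq i0 => e; apply/eqP/val_inj.
have i_le : (i <= n)%N.
  rewrite -ltnS ltn_neqAle -ltnS ltn_ord andbT.
  by apply: contraNneq im => e; apply/eqP/val_inj.
have -> : lift i (ord0 : 'I_n.+1) = ord0.
  by apply: val_inj; rewrite /= /bump leqNgt i_gt0.
have -> // : lift i (ord_max : 'I_n.+1) = ord_max.
by apply: val_inj; rewrite /= /bump i_le.
Qed.

Lemma coface_subproof n (i : 'I_n.+2) (h : bimod_hom n) :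
  coface_fun i h \in @is_bimod n.+1.
Proof.
apply/is_bimod_basisP => c; have [k hk] := bimod_tbasis h (face i c).
by exists k; apply: coface_fun_tbasis.
Qed.

Definition hcoface n (i : 'I_n.+2) (h : bimod_hom n) : bimod_hom n.+1 :=
  BimodHom (coface_subproof i h).

Lemma codegen_subproof n (i : 'I_n.+1) (h : bimod_hom n.+1) :
  (h \o tdegen i)%VF \in @is_bimod n.
Proof.
apply/is_bimod_basisP => c; have [k hk] := bimod_tbasis h (degen i c).
exists k; rewrite comp_lfunE tdegen_tbasis hk !ffunE.
have -> : unlift_ord i ord0 = ord0 by apply: ord_inj; rewrite val_unlift_ord.
have -> // : unlift_ord i ord_max = ord_max.
by apply: ord_inj; rewrite val_unlift_ord /= leqNgt ltn_ord.
Qed.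

Definition hcodegen n (i : 'I_n.+1) (h : bimod_hom n.+1) : bimod_hom n :=
  BimodHom (codegen_subproof i h).

Definition hdiff n (h : bimod_hom n) : bimod_hom n.+1 :=
  \sum_(i < n.+2) (-1) ^+ i *: hcoface i h.

(* The functional sending every basis element (x, y) to 1. *)
Definition aug (a : I) : K := \sum_p a p.

Lemma aug_pr k x y : (x <= y)%O -> aug (k *: pr x y) = k.
Proof.
move=> xy; rewrite /aug (bigD1 (exist _ (x, y) xy : pairs P)) //= !ffunE eqxx.
rewrite big1 ?addr0 /GRing.scale /= ?mulr1 // => p pxy; rewrite !ffunE.
case: eqP => [e|_]; last by rewrite /GRing.scale /= mulr0.
by case/eqP: pxy; apply: val_inj.
Qed.

Lemma aug_sum n (h : 'Hom(tens n, I)) t :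
  aug (h t) = \sum_c t c * aug (h (tbasis c)).
Proof.
rewrite {1}(tens_expand t) linear_sum /aug.
under eq_bigr => p _ do rewrite sum_ffunE.
rewrite exchange_big; apply: eq_bigr => c _; rewrite mulr_sumr.
by apply: eq_bigr => p _; rewrite linearZ ffunE.
Qed.

Lemma aug_inj n (g h : bimod_hom n) : (forall t, aug (g t) = aug (h t)) -> g = h.
Proof.
move=> gh; apply/val_inj/tens_ext => c; move: (gh (tbasis c)) => /=.
have [k ->] := bimod_tbasis g c; have [k' ->] := bimod_tbasis h c.
by rewrite !aug_pr ?nerve_ends // => ->.
Qed.

Lemma coface_dual n (i : 'I_n.+2) (h : bimod_hom n) t :
  aug (hcoface i h t) = aug (h (tface i t)).
Proof.
rewrite -comp_lfunE !aug_sum; apply: eq_bigr => c _; congr (_ * _).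
have [k hk] := bimod_tbasis h (face i c).
rewrite comp_lfunE tface_tbasis hk [hcoface _ _ _](coface_fun_tbasis hk).
by rewrite !aug_pr ?nerve_ends.
Qed.

Lemma coface_comp n (i : 'I_n.+2) (h : bimod_hom n) :
  (h \o tface i)%VF \in @is_bimod n.+1 ->
  hcoface i h = (h \o tface i)%VF :> 'Hom(tens n.+1, I).
Proof.
move=> hi; rewrite -[RHS]/(bimod_val (BimodHom hi)); congr bimod_val.
by apply: aug_inj => t; rewrite coface_dual comp_lfunE.
Qed.

Lemma outer_face_not_bimod (x y : P) : (x < y)%O ->
  exists h : bimod_hom 0, (h \o tface ord0)%VF \notin @is_bimod 1.
Proof.
move=> xy; exists (iotaH [ffun=> 1]); apply/negP => /is_bimod_basisP.
have c_mono : monotone [ffun j : 'I_2 => if j == ord0 then x else y].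
  apply/forallP => i; apply/forallP => j; apply/implyP; rewrite !ffunE.
  case: (eqVneq j ord0) => [-> |_].
    rewrite leqn0 => i0; suff -> : i == ord0 by [].
    by rewrite -val_eqE.
  by case: eqP => _ _ //; apply: ltW.
move=> /(_ (Nerve c_mono)) [k]; rewrite comp_lfunE tface_tbasis iotaH_tbasis.
move=> /(congr1 (fun a => icoef a y y)).
have xyN : (y == x) = false by apply/negbTE; rewrite eq_sym lt_eqF.
rewrite !ffunE /= !icoefZ !icoef_pr ?(ltW xy) // xyN !eqxx mulr0 mulr1.
by move/eqP; rewrite oner_eq0.
Qed.

Definition tens0_inc : 'Hom(tens 0, I) :=
  lext (fun c : nerve 0 => pr (c ord0) (c ord0)).

Lemma tens0_diag :
  [/\ injective tens0_inc,
      forall a, a \in inc_diag <-> exists t, tens0_inc t = a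
    & forall s, s \in inc_diag -> forall t,
        tens0_inc (lact s t) = s * tens0_inc t /\
        tens0_inc (ract t s) = tens0_inc t * s].
Proof.
have c0E (c : nerve 0) (i : 'I_1) : c i = c ord0 by rewrite ord1.
have icoefc t x : icoef (tens0_inc t) x x = \sum_(c : nerve 0 | c ord0 == x) t c.
  rewrite lextE [RHS]big_mkcond /=; elim/big_rec2: _ => [|c u v _ <-]; first exact: icoef0.
  rewrite icoefD icoefZ icoef_pr // andbb eq_sym.
  by case: eqP; rewrite ?mulr1 ?mulr0.
have nerve0P (c d : nerve 0) : c ord0 = d ord0 -> c = d.
  by move=> cd; apply/val_inj/ffunP => i; rewrite !(c0E _ i).
split.
- move=> t u tu; apply/ffunP => c.
  move: (congr1 (fun a => icoef a (c ord0) (c ord0)) tu); rewrite /= !icoefc.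
  by rewrite !(big_pred1 c) // => d; apply/eqP/eqP => [/nerve0P|->].
- move=> a; split=> [Sa|[t <-]].
    exists [ffun c : nerve 0 => icoef a (c ord0) (c ord0)]; rewrite lextE.
    have c_mono (x : P) : monotone [ffun _ : 'I_1 => x].
      by apply/forallP => i; apply/forallP => j; rewrite !ffunE lexx implybT.
    rewrite [RHS](inc_diag_expand Sa).
    rewrite [RHS](reindex (fun c : nerve 0 => c ord0)) /=.
      by apply: eq_bigr => c _; rewrite ffunE.
    exists (fun x => Nerve (c_mono x)) => [c _|x _]; last by rewrite ffunE.
    by apply: nerve0P; rewrite ffunE.
  rewrite lextE; apply/asboolP => B [B1 Blin _] Bpr; elim/big_rec: _ => [|c b _ Bb].
    by have := Blin (-1) 1 1 B1 B1; rewrite scaleN1r addNr.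
  exact: Blin.
have : tens0_inc \in @is_bimod 0.
  by apply/is_bimod_basisP => c; exists 1; rewrite lext_tbasis scale1r (c0E c ord_max).
by move/is_bimodP.
Qed.

Definition tprod n (a : 'I_n.+1 -> I) : tens n.+1 :=
  [ffun c : nerve n.+1 =>
     \prod_i icoef (a i) (c (widen_ord (leqnSn n.+1) i)) (c (lift ord0 i))].

Definition slot n (a : 'I_n -> I) (i : 'I_n) (u : I) : 'I_n -> I :=
  fun j => if j == i then u else a j.

Definition balanced n (V : lmodType K) (phi : ('I_n.+1 -> I) -> V) : Prop :=
  (forall a i k u v,
     phi (slot a i (k *: u + v)) = k *: phi (slot a i u) + phi (slot a i v)) /\
  (forall a (i j : 'I_n.+1) s, j = i.+1 :> nat -> s \in inc_diag ->
     phi (slot a i (a i * s)) = phi (slot a j (s * a j))).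

Definition steps n (c : nerve n.+1) : 'I_n.+1 -> I :=
  fun i => pr (c (widen_ord (leqnSn n.+1) i)) (c (lift ord0 i)).

Lemma slot_id n (a : 'I_n -> I) i : slot a i (a i) = a.
Proof. by apply/funext => j; rewrite /slot; case: eqP => [->|]. Qed.

Lemma step_le n (c : nerve n.+1) (i : 'I_n.+1) :
  (c (widen_ord (leqnSn n.+1) i) <= c (lift ord0 i))%O.
Proof. by apply: nerve_le. Qed.

Lemma tbasis_steps n (c : nerve n.+1) : tbasis c = tprod (steps c).
Proof.
apply/ffunP => d; rewrite !ffunE; case: eqP => [->|dc].
  by rewrite big1 // => i _; rewrite icoef_pr ?step_le // !eqxx.
have [k dk] : exists k, d k != c k.
  apply/existsP; apply: contra_notT dc; rewrite negb_exists => /forallP H.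
  by apply/val_inj/ffunP => k; apply/eqP; move: (H k); rewrite negbK.
have [i ki] : exists i : 'I_n.+1, k = widen_ord (leqnSn n.+1) i \/ k = lift ord0 i.
  case: (unliftP ord0 k) => [i ->|->]; first by exists i; right.
  by exists ord0; left; apply: val_inj.
rewrite (bigD1 i) //= icoef_pr ?step_le //.
by case: ki dk => -> /negbTE ->; rewrite ?andbF mul0r.
Qed.

Lemma icoef_diag_mulr (s a : I) x y : s \in inc_diag ->
  icoef (a * s) x y = icoef a x y * icoef s y y.
Proof.
move=> Ss; rewrite icoefM (bigD1 y) //= big1 ?addr0 // => z zy.
by rewrite (inc_diagP Ss) ?mulr0.
Qed.

Lemma icoef_diag_mull (s a : I) x y : s \in inc_diag ->
  icoef (s * a) x y = icoef s x x * icoef a x y.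
Proof.
move=> Ss; rewrite icoefM (bigD1 x) //= big1 ?addr0 // => z zx.
by rewrite (inc_diagP Ss) ?mul0r // eq_sym.
Qed.

Lemma tprod_slot n (a : 'I_n.+1 -> I) i u (c : nerve n.+1) :
  tprod (slot a i u) c = icoef u (c (widen_ord (leqnSn n.+1) i)) (c (lift ord0 i)) *
   \prod_(j | j != i) icoef (a j) (c (widen_ord (leqnSn n.+1) j)) (c (lift ord0 j)).
Proof.
rewrite ffunE (bigD1 i) //= {1}/slot eqxx; congr (_ * _).
by apply: eq_bigr => j /negbTE ji; rewrite /slot ji.
Qed.

Lemma tprod_balanced n : balanced (@tprod n).
Proof.
split=> [a i k u v|a i j s ji Ss]; apply/ffunP => c.
  by rewrite tprod_slot icoefD icoefZ 2!ffunE /GRing.scale /= !tprod_slot mulrDl mulrA.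
rewrite !tprod_slot icoef_diag_mulr // icoef_diag_mull //.
rewrite mulrAC -[RHS]mulrA [RHS]mulrC; congr (_ * _); last first.
  by have -> : widen_ord (leqnSn n.+1) j = lift ord0 i by apply: val_inj.
pose G := \prod_k icoef (a k) (c (widen_ord (leqnSn n.+1) k)) (c (lift ord0 k)).
by transitivity G; [rewrite [RHS](bigD1 i) | rewrite [LHS](bigD1 j)].
Qed.

Lemma lact_tprod n s (a : 'I_n.+1 -> I) : s \in inc_diag ->
  lact s (tprod a) = tprod (slot a ord0 (s * a ord0)).
Proof.
move=> Ss; apply/ffunP => c; rewrite tprod_slot icoef_diag_mull // !ffunE.
rewrite (bigD1 ord0) //= mulrA.
by have -> : widen_ord (leqnSn n.+1) ord0 = ord0 by apply: val_inj.
Qed.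

Lemma ract_tprod n s (a : 'I_n.+1 -> I) : s \in inc_diag ->
  ract (tprod a) s = tprod (slot a ord_max (a ord_max * s)).
Proof.
move=> Ss; apply/ffunP => c; rewrite tprod_slot icoef_diag_mulr // !ffunE.
rewrite (bigD1 ord_max) //= mulrAC.
by have -> : lift ord0 (ord_max : 'I_n.+1) = ord_max by apply: val_inj.
Qed.

Lemma balanced_slot_sum n (V : lmodType K) (phi : ('I_n.+1 -> I) -> V) a i
    (J : finType) (k : J -> K) (u : J -> I) : balanced phi ->
  phi (slot a i (\sum_j k j *: u j)) = \sum_j k j *: phi (slot a i (u j)).
Proof.
case=> lin _; elim/big_rec2: _ => [|j x y _ <-]; last by rewrite lin.
by have := lin a i (-1) 0 0; rewrite scaler0 add0r scaleN1r addNr.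
Qed.

Lemma balanced_eq n (V : lmodType K) (phi psi : ('I_n.+1 -> I) -> V) :
    balanced phi -> balanced psi ->
  (forall c, phi (steps c) = psi (steps c)) -> phi =1 psi.
Proof.
move=> phiP psiP eqc.
pose e (p : 'I_n.+1 -> pairs P) : 'I_n.+1 -> I :=
  fun i => pr (val (p i)).1 (val (p i)).2.
have eqe p : phi (e p) = psi (e p).
  have [/forallP comp|] := boolP [forall i : 'I_n.+1, forall j : 'I_n.+1,
      (j == i.+1 :> nat) ==> ((val (p i)).2 == (val (p j)).1)].
    pose v (k : nat) : P :=
      if k is k'.+1 then (val (p (inord k'))).2 else (val (p ord0)).1.
    have vlt i : (i <= n)%N -> v i = (val (p (inord i))).1.
      case: i => [|i] lin /=; first by congr (val (p _)).1; apply: val_inj; rewrite /= inordK.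
      move: (comp (inord i)) => /forallP/(_ (inord i.+1)).
      by rewrite !inordK // ?eqxx => [/eqP //|]; rewrite ltnW.
    have vS i : (i <= n)%N -> (v i <= v i.+1)%O.
      by move=> lin; rewrite vlt //=; case: (p _).
    have v_mono : monotone [ffun k : 'I_n.+2 => v k].
      apply/forallP => i; apply/forallP => j; apply/implyP; rewrite !ffunE.
      case: j => j /=; rewrite ltnS; elim: j => [|j IH] lj.
        by rewrite leqn0 => /eqP ->.
      rewrite leq_eqVlt => /orP[/eqP -> //|]; rewrite ltnS => ij.
      by apply: le_trans (vS j lj); apply: IH ij; apply: ltnW.
    suff -> : e p = steps (Nerve v_mono) by exact: eqc.
    apply/funext => i; rewrite /e /steps !ffunE /= vlt -1?ltnS ?ltn_ord //.
    by rewrite inord_val.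
  rewrite negb_forall => /existsP[i]; rewrite negb_forall => /existsP[j].
  rewrite negb_imply => /andP[/eqP ji ncomp].
  suff van (f : ('I_n.+1 -> I) -> V) : balanced f -> f (e p) = 0 by rewrite !van.
  move=> fP; have := (fP.2 (e p) i j _ ji (pr_diag K (val (p i)).2)).
  have le_p l : ((val (p l)).1 <= (val (p l)).2)%O by case: (p l).
  rewrite {2 4}/e !pr_mul // eqxx (negbTE ncomp) slot_id => ->.
  have := balanced_slot_sum (e p) j (fun _ : 'I_0 => 0) (fun _ => 0) fP.
  by rewrite !big_ord0.
have eqk k a : (forall i : 'I_n.+1, (k <= i)%N ->
    exists p : pairs P, a i = pr (val p).1 (val p).2) -> phi a = psi a.
  elim: k a => [|k IH] a ak.
    have [p pE] := choice (fun i => ak i isT).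
    by have -> : a = e p by apply/funext.
  case: (ltnP k n.+1) => kn; last first.
    by apply: IH => i ki; move: (leq_trans kn ki); rewrite leqNgt ltn_ord.
  pose o := Ordinal kn; rewrite -(slot_id a o) (inc_expand (a o)).
  rewrite !balanced_slot_sum //; apply: eq_bigr => p _; congr (_ *: _).
  apply: IH => i ki; rewrite /slot; case: eqP => [_|io]; first by exists p.
  apply: ak; rewrite ltn_neqAle ki andbT.
  by apply/eqP => ki'; apply: io; apply: val_inj.
by move=> a; apply: (eqk n.+1) => i; rewrite leqNgt ltn_ord.
Qed.

Lemma tprod_universal n (V : lmodType K) (phi : ('I_n.+1 -> I) -> V) :
  balanced phi ->
  exists2 g : {linear tens n.+1 -> V}, (forall a, g (tprod a) = phi a)
    & forall g' : {linear tens n.+1 -> V},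
        (forall a, g' (tprod a) = phi a) -> g' =1 g.
Proof.
move=> phiP; pose g0 (t : tens n.+1) : V := \sum_c t c *: phi (steps c).
have lin : linear g0.
  move=> k x y; rewrite /g0 scaler_sumr -big_split /=.
  by apply: eq_bigr => c _; rewrite !ffunE scalerDl scalerA.
pose L := GRing.isLinear.Build _ _ _ _ _ lin.
pose g : {linear tens n.+1 -> V} := HB.pack g0 L.
have gP : forall a, g (tprod a) = phi a.
  have [tl tb] := tprod_balanced n.
  apply: balanced_eq => //.
    by split=> [a i k u v|a i j s ji Ss]; rewrite ?tl ?linearP // (tb _ _ _ _ ji Ss).
  move=> c; rewrite -tbasis_steps /= /g0 (bigD1 c) //= ffunE eqxx scale1r.
  by rewrite big1 ?addr0 // => d dc; rewrite ffunE (negbTE dc) scale0r.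
exists g => // g' g'P t; rewrite (tens_expand t) !linear_sum.
by apply: eq_bigr => c _; rewrite !linearZ /= tbasis_steps g'P -gP.
Qed.

End Complexes.

(* Main.v *)
Require Import Defs.
From HB Require Import structures.
From mathcomp Require Import all_boot all_order all_algebra.

Set Implicit Arguments.
Unset Strict Implicit.
Unset Printing Implicit Defensive.

Import Order.TTheory GRing.Theory.

Local Open Scope ring_scope.

(** A basis tensor with end vertices [x] and [y] is fixed by [(x, x)] acting on
    the left and by [(y, y)] acting on the right, so a bimodule morphism sends
    it into the line spanned by [(x, y)].
    A morphism is therefore the same thing as a choice of one scalar for each
    simplex of the nerve, that is, a singular cochain; this is [iotaH], and
    the inverse reads the scalars off through the augmentation [aug].

    Since a morphism is determined by its values on basis tensors
    ([bimod_ext]), all the compatibilities are checked there.  An inner face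
    keeps the end vertices of a simplex, and an outer coface multiplies back
    the factor that the outer face drops; in both cases the coface carries the
    coefficient of [face i c] to [c], exactly as the singular coface does.  A
    degeneracy does not move the end vertices.  Finally both differentials are
    the same alternating sum of cofaces, so [iotaH] commutes with them because
    it is linear and commutes with the cofaces. *)

Section Iota.

Context {disp : Order.disp_t} (P : finPOrderType disp) (K : fieldType).

Lemma bimod_ext n (g h : bimod_hom P K n) :
  (forall c, g (tbasis K c) = h (tbasis K c)) -> g = h.
Proof. by move=> gh; apply/val_inj/tens_ext. Qed.

Lemma iotaH_linear n : linear (@iotaH disp P K n).
Proof.
move=> k f g; apply: bimod_ext => c.
by rewrite add_lfunE scale_lfunE !iotaH_tbasis !ffunE scalerDl scalerA.
Qed.

(** The scalar by which [h] multiplies the basis element joining the ends of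
    [c]: its existence is the content of [bimod_tbasis], and [aug] extracts it
    because it sends every basis element of the incidence algebra to 1. *)
Definition bimod_coef n (h : bimod_hom P K n) : cochain P K n :=
  [ffun c => aug (h (tbasis K c))].

Lemma iotaHK n : cancel (@iotaH disp P K n) (@bimod_coef n).
Proof.
by move=> f; apply/ffunP => c; rewrite ffunE iotaH_tbasis aug_pr ?nerve_ends.
Qed.

Lemma bimod_coefK n : cancel (@bimod_coef n) (@iotaH disp P K n).
Proof.
move=> h; apply: bimod_ext => c; rewrite iotaH_tbasis ffunE.
by have [k ->] := bimod_tbasis h c; rewrite aug_pr ?nerve_ends.
Qed.

Lemma iotaH_coface n (i : 'I_n.+2) (f : cochain P K n) :
  hcoface i (iotaH f) = iotaH (ccoface i f).
Proof.
apply: bimod_ext => c; rewrite iotaH_tbasis ffunE.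
exact: coface_fun_tbasis (iotaH_tbasis f (face i c)).
Qed.

(** The two sides are supported on the ends of [degen i c] and of [c], which
    coincide; comparing augmentations leaves only the coefficients. *)
Lemma iotaH_codegen n (i : 'I_n.+1) (f : cochain P K n.+1) :
  hcodegen i (iotaH f) = iotaH (ccodegen i f).
Proof.
apply: (can_inj (@bimod_coefK n)); apply/ffunP => c; rewrite !ffunE.
rewrite comp_lfunE tdegen_tbasis lext_tbasis iotaH_tbasis.
by rewrite !aug_pr ?nerve_ends // ffunE.
Qed.

Lemma iotaH_diff n (f : cochain P K n) : hdiff (iotaH f) = iotaH (cdiff f).
Proof.
pose L := GRing.isLinear.Build _ _ _ _ _ (@iotaH_linear n.+1).
pose iota : {linear cochain P K n.+1 -> bimod_hom P K n.+1} :=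
  HB.pack (@iotaH disp P K n.+1) L.
rewrite -[RHS]/(iota (cdiff f)) linear_sum; apply: eq_bigr => i _.
by rewrite linearZ /= iotaH_coface.
Qed.

End Iota.

Theorem theorem4p1 (disp : Order.disp_t) (P : finPOrderType disp)
    (K : fieldType) :
  [/\ (* iotaH is an isomorphism of cochain complexes *)
      (forall n : nat, linear (@iotaH disp P K n) /\ bijective (@iotaH disp P K n)),
      (forall (n : nat) (f : cochain P K n), hdiff (iotaH f) = iotaH (cdiff f)),
      (* which commutes with the cofaces and the codegeneracies *)
      (forall (n : nat) (i : 'I_n.+2) (f : cochain P K n),
         hcoface i (iotaH f) = iotaH (ccoface i f))
    & (forall (n : nat) (i : 'I_n.+1) (f : cochain P K n.+1),
         hcodegen i (iotaH f) = iotaH (ccodegen i f))].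
Proof.
split=> [n|n f|n i f|n i f].
- split; first exact: iotaH_linear.
  exact: Bijective (@iotaHK _ P K n) (@bimod_coefK _ P K n).
- exact: iotaH_diff.
- exact: iotaH_coface.
- exact: iotaH_codegen.
Qed.
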